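(* Let $M,D>0$ and let $N\ge 5$ be an integer. There is no $W\in\mathbb{L}^N$ whose iterates $x_0,\dots,x_N$ are each minimax optimal at their iteration; that is, there is no $W\in\mathbb{L}^N$ such that for every $n=0,1,\dots,N$, $$\max\,\{f(x_n)-f(x_\star)\}=\frac{MD}{\sqrt{n+1}},$$ where the maximum is over all $(f,x_0)\in\mathtt{P}_{M,D}$ and all choices of subgradients $g_i\in\partial f(x_i)$ used by the fixed-step method with stepsize matrix $W$.
   Context: $\mathbb{L}^N$ is the set of real lower triangular $N\times N$ matrices $W$, with rows indexed $1,\dots,N$ and columns indexed $0,\dots,N-1$; so the (possibly nonzero) entries are $W_{n,j}$, $0\le j<n\le N$. $\mathtt{P}_{M,D}$ is the set of all pairs $(f,x_0)$, over all dimensions $d$, with $f:\mathbb{R}^d\to\mathbb{R}$ convex and $M$-Lipschitz (Euclidean norm), $x_0\in\mathbb{R}^d$, such that $f$ attains its minimum at some $x_\star$ with $\|x_0-x_\star\|\le D$. The fixed-step first-order method with stepsize matrix $W$ iterates $x_n=x_0-\sum_{i=0}^{n-1}W_{n,i}g_i$, $n=1,\dots,N$, where $g_i\in\partial f(x_i)$ are arbitrary subgradients. It is known that for an $n$-step method the minimax optimal (smallest possible) worst-case value of $f(x_n)-f(x_\star)$ over $\mathtt{P}_{M,D}$, among all methods with $x_m\in x_0-\mathrm{span}\{g_0,\dots,g_{m-1}\}$, is $\frac{MD}{\sqrt{n+1}}$. *)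

(* Defs.v *)
From HB Require Import structures.
From mathcomp Require Import all_boot all_order all_algebra.
From mathcomp Require Import classical_sets reals convex.

Set Implicit Arguments.
Unset Strict Implicit.
Unset Printing Implicit Defensive.

Import Order.TTheory GRing.Theory Num.Theory.

Local Open Scope classical_set_scope.
Local Open Scope ring_scope.

(* The norm that mathcomp-analysis puts on matrices is the sup norm, so the
   Euclidean norm and the Lipschitz condition for it are defined here. *)
Definition dotv (R : realType) (d : nat) (u v : 'rV[R]_d) : R :=
  \sum_i u 0 i * v 0 i.

Definition enorm (R : realType) (d : nat) (u : 'rV[R]_d) : R :=
  Num.sqrt (dotv u u).

Definition elipschitz (R : realType) (d : nat) (M : R) (f : 'rV[R]_d -> R) :
    Prop :=
  forall x y : 'rV[R]_d, `|f x - f y| <= M * enorm (x - y).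

Definition subdifferential (R : realType) (d : nat) (f : 'rV[R]_d -> R)
    (x : 'rV[R]_d) : set 'rV[R]_d :=
  [set g | forall y : 'rV[R]_d, f x + dotv g (y - x) <= f y].

Definition minimizer (R : realType) (d : nat) (f : 'rV[R]_d -> R)
    (xstar : 'rV[R]_d) : Prop :=
  forall y : 'rV[R]_d, f xstar <= f y.

Definition problem_class (R : realType) (M D : R) (d : nat)
    (f : 'rV[R]_d -> R) (x0 : 'rV[R]_d) : Prop :=
  [/\ convex_function [set: 'rV[R]_d] f,
      elipschitz M f &
      exists2 xstar : 'rV[R]_d, minimizer f xstar & enorm (x0 - xstar) <= D].

(* Rows of W are indexed by 1, ..., N on paper and by 'I_N here: the paper
   entry W_{n,j} is W k j with n = k.+1. Hence "W_{n,j} = 0 unless j < n" is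
   is_trig_mx W, and lift ord0 k : 'I_N.+1 is the iteration number k.+1. *)
Definition fixed_step_run (R : realType) (N : nat) (W : 'M[R]_N) (d : nat)
    (f : 'rV[R]_d -> R) (x : 'I_N.+1 -> 'rV[R]_d) (g : 'I_N -> 'rV[R]_d) :
    Prop :=
  (forall i : 'I_N, subdifferential f (x (widen_ord (leqnSn N) i)) (g i)) /\
  (forall k : 'I_N,
     x (lift ord0 k) = x ord0 - \sum_(i < N | (i < k.+1)%N) W k i *: g i).

Definition performance (R : realType) (M D : R) (N : nat) (W : 'M[R]_N)
    (n : 'I_N.+1) : set R :=
  [set v | exists (d : nat) (f : 'rV[R]_d -> R) (x : 'I_N.+1 -> 'rV[R]_d)
      (g : 'I_N -> 'rV[R]_d) (xstar : 'rV[R]_d),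
    [/\ problem_class M D f (x ord0), minimizer f xstar,
        fixed_step_run W f x g & v = f (x n) - f xstar]].

Definition is_max (R : realType) (S : set R) (m : R) : Prop :=
  S m /\ ubound S m.

(* Main.v *)
(* The worst functions for an optimal [n]-step method are maxima of [n + 1]
   affine functions whose gradients are the orthonormal vectors [e_0, ..., e_n].
   Optimality must survive moving one gradient [e_p] to [e_p + e u], with [u]
   orthogonal to [e_p], while shifting the values at the iterates by [e phi];
   the terms of order [e] give linear inequalities on the stepsizes
   [w i j = W_{i,j} M / D].  For [n = 1, 2] they yield
   [w 1 0 <= 1 / (2 sqrt 2)], [w 2 1 <= 1 / (3 sqrt 3)] and
   [w 2 0 >= 2 / (3 sqrt 3)].  For [n = 5], moving only [e_2] inside the span of
   [e_0, e_1, e_2] yields [w 1 0 + ((w 2 0 - w 1 0) / w 2 1 - 1) / sqrt 6 <= 0],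
   which these bounds contradict. *)
Require Import Defs.
From mathcomp Require Import all_boot all_order all_algebra.
From mathcomp Require Import boolp classical_sets reals convex interval_inference.
From mathcomp Require Import ring lra.

Set Implicit Arguments.
Unset Strict Implicit.
Unset Printing Implicit Defensive.

Import Order.TTheory GRing.Theory Num.Theory.

Local Open Scope ring_scope.

(** * Euclidean inner product and norm *)

Lemma dotvC (R : realType) (d : nat) (u v : 'rV[R]_d) : dotv u v = dotv v u.
Proof. by apply: eq_bigr => i _; rewrite mulrC. Qed.

Lemma dotvDr (R : realType) (d : nat) (u v w : 'rV[R]_d) :
  dotv u (v + w) = dotv u v + dotv u w.
Proof. by rewrite -big_split; apply: eq_bigr => i _; rewrite mxE mulrDr. Qed.

Lemma dotvZr (R : realType) (d : nat) (a : R) (u v : 'rV[R]_d) :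
  dotv u (a *: v) = a * dotv u v.
Proof. by rewrite mulr_sumr; apply: eq_bigr => i _; rewrite mxE mulrCA. Qed.

Lemma dotvZl (R : realType) (d : nat) (a : R) (u v : 'rV[R]_d) :
  dotv (a *: u) v = a * dotv u v.
Proof. by rewrite dotvC dotvZr dotvC. Qed.

Lemma dotvNr (R : realType) (d : nat) (u v : 'rV[R]_d) :
  dotv u (- v) = - dotv u v.
Proof. by rewrite -scaleN1r dotvZr mulN1r. Qed.

Lemma dotvBr (R : realType) (d : nat) (u v w : 'rV[R]_d) :
  dotv u (v - w) = dotv u v - dotv u w.
Proof. by rewrite dotvDr dotvNr. Qed.

Lemma dotv0l (R : realType) (d : nat) (u : 'rV[R]_d) : dotv 0 u = 0.
Proof. by rewrite -(scale0r u) dotvZl mul0r. Qed.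

Lemma enormN (R : realType) (d : nat) (u : 'rV[R]_d) : enorm (- u) = enorm u.
Proof. by rewrite /enorm dotvNr dotvC dotvNr opprK. Qed.

Lemma dotv_sumr (R : realType) (d : nat) (u : 'rV[R]_d) (I : Type)
    (r : seq I) (P : pred I) (v : I -> 'rV[R]_d) :
  dotv u (\sum_(i <- r | P i) v i) = \sum_(i <- r | P i) dotv u (v i).
Proof.
elim/big_rec2 : _ => [|i y1 y2 _ <-]; last by rewrite dotvDr.
by rewrite dotvC dotv0l.
Qed.

Lemma dotv_ge0 (R : realType) (d : nat) (u : 'rV[R]_d) : 0 <= dotv u u.
Proof. by apply: sumr_ge0 => i _; rewrite -expr2 sqr_ge0. Qed.

Lemma dotv_eq0 (R : realType) (d : nat) (u v : 'rV[R]_d) :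
  dotv u u = 0 -> dotv u v = 0.
Proof.
move/eqP; rewrite psumr_eq0 => [/allP u0|i _]; last by rewrite -expr2 sqr_ge0.
rewrite /dotv big1 // => i _; have := u0 i (mem_index_enum i).
by rewrite mulf_eq0 orbb => /eqP ->; rewrite mul0r.
Qed.

Lemma cauchy_schwarz (R : realType) (d : nat) (u v : 'rV[R]_d) :
  dotv u v <= enorm u * enorm v.
Proof.
rewrite -sqrtrM ?dotv_ge0 //; apply: le_trans (ler_norm _) _.
rewrite -sqrtr_sqr ler_wsqrtr //.
have [u0|u0] := eqVneq (dotv u u) 0; first by rewrite dotv_eq0 // u0 mul0r expr0n.
have {}u0 : 0 < dotv u u by rewrite lt0r u0 dotv_ge0.
have := dotv_ge0 (dotv u u *: v - dotv u v *: u).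
rewrite dotvBr !dotvZr ![dotv (_ - _) _]dotvC !dotvBr !dotvZr (dotvC v u).
set a := dotv u u; set c := dotv u v; set b := dotv v v.
have -> : a * (a * b - c * c) - c * (a * c - c * a) = a * (a * b - c ^+ 2) by ring.
by rewrite pmulr_rge0 // subr_ge0.
Qed.

(** * Maxima of finitely many affine functions *)

(* The floor [v] makes the maximum of affine functions attain its minimum. *)
Definition max_affine (R : realType) (d m : nat) (v : R) (c : 'I_m -> R)
    (G : 'I_m -> 'rV[R]_d) (x : 'rV[R]_d) : R :=
  \big[Order.max/v]_j (c j + dotv (G j) x).

Lemma max_affineP (R : realType) (d m : nat) (v : R) (c : 'I_m -> R)
    (G : 'I_m -> 'rV[R]_d) (x : 'rV[R]_d) (t : R) :
  reflect (v <= t /\ forall j, c j + dotv (G j) x <= t)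
          (max_affine v c G x <= t).
Proof.
by apply: (iffP (bigmax_leP _ _ _ _)) => -[vt H]; split=> // j *; exact: H.
Qed.

Lemma max_affine_ge (R : realType) (d m : nat) (v : R) (c : 'I_m -> R)
    (G : 'I_m -> 'rV[R]_d) (x : 'rV[R]_d) (j : 'I_m) :
  c j + dotv (G j) x <= max_affine v c G x.
Proof. by have /max_affineP[] := lexx (max_affine v c G x). Qed.

Lemma max_affine_floor (R : realType) (d m : nat) (v : R) (c : 'I_m -> R)
    (G : 'I_m -> 'rV[R]_d) (x : 'rV[R]_d) :
  v <= max_affine v c G x.
Proof. by have /max_affineP[] := lexx (max_affine v c G x). Qed.

Lemma max_affine_subgradient (R : realType) (d m : nat) (v : R)
    (c : 'I_m -> R) (G : 'I_m -> 'rV[R]_d) (x : 'rV[R]_d) (j : 'I_m) :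
  max_affine v c G x <= c j + dotv (G j) x ->
  subdifferential (max_affine v c G) x (G j).
Proof.
move=> xj y; rewrite dotvBr.
apply: le_trans (max_affine_ge v c G y j); lra.
Qed.

Lemma max_affine_subdifferential (R : realType) (d m : nat) (v : R)
    (c : 'I_m -> R) (G : 'I_m -> 'rV[R]_d) (x : 'rV[R]_d) :
  exists g, subdifferential (max_affine v c G) x g.
Proof.
have [xv|vx] := leP (max_affine v c G x) v.
  exists 0 => y; rewrite dotv0l addr0.
  exact: le_trans (max_affine_floor _ _ _ _).
have /bigmax_geP [|[j _ xj]] := lexx (max_affine v c G x).
  by rewrite leNgt vx.
by exists (G j); exact: max_affine_subgradient.
Qed.

Lemma max_affine_lipschitz (R : realType) (d m : nat) (M v : R)
    (c : 'I_m -> R) (G : 'I_m -> 'rV[R]_d) : 0 <= M ->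
  (forall j, enorm (G j) <= M) -> elipschitz M (max_affine v c G).
Proof.
move=> M0 GM.
have half x y : max_affine v c G x <= max_affine v c G y + M * enorm (x - y).
  apply/max_affineP; split=> [|j].
    by rewrite ler_wpDr ?max_affine_floor // mulr_ge0 // sqrtr_ge0.
  have {1}-> : x = y + (x - y) by rewrite addrC subrK.
  rewrite dotvDr addrA lerD ?max_affine_ge //.
  apply: le_trans (cauchy_schwarz _ _) _.
  by rewrite ler_wpM2r ?sqrtr_ge0.
move=> x y; rewrite ler_norml lerBlDl half andbT.
have -> : enorm (x - y) = enorm (y - x) by rewrite -enormN opprB.
by rewrite lerBrDr addrC -lerBrDr opprK half.
Qed.

Lemma max_affine_convex (R : realType) (d m : nat) (v : R) (c : 'I_m -> R)
    (G : 'I_m -> 'rV[R]_d) : convex_function setT (max_affine v c G).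
Proof.
move=> t x y _ _.
suff: forall s : R, 0 <= s -> s <= 1 ->
    max_affine v c G (s *: (x : 'rV[R]_d) + (1 - s) *: (y : 'rV[R]_d)) <=
    s * max_affine v c G x + (1 - s) * max_affine v c G y.
  by apply.
move=> s s0 s1; have {}s1 : 0 <= 1 - s by rewrite subr_ge0.
apply/max_affineP; split=> [|j].
  have {1}-> : v = s * v + (1 - s) * v by ring.
  by apply: lerD; rewrite ler_wpM2l // max_affine_floor.
rewrite dotvDr !dotvZr.
have -> : forall a b : R, c j + (s * a + (1 - s) * b) =
   s * (c j + a) + (1 - s) * (c j + b).
  by move=> a b; ring.
by apply: lerD; rewrite ler_wpM2l // max_affine_ge.
Qed.

(** * Runs of the method *)

Definition iterate (R : realType) (d : nat) (w : nat -> nat -> R)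
    (x0 : 'rV[R]_d) (g : nat -> 'rV[R]_d) (i : nat) : 'rV[R]_d :=
  x0 - \sum_(l < i) w i l *: g l.

Lemma eq_iterate (R : realType) (d : nat) (w : nat -> nat -> R)
    (x0 : 'rV[R]_d) (g h : nat -> 'rV[R]_d) (i : nat) :
  (forall l, (l < i)%N -> g l = h l) -> iterate w x0 g i = iterate w x0 h i.
Proof.
by move=> gh; congr (_ - _); apply: eq_bigr => l _; rewrite gh.
Qed.

(** The [i]-th iterate involves only subgradients of index below [i], so prescribed ones stay valid
    while arbitrary ones are appended. A bad case for iterate [n] thus extends to a full run. *)
Lemma extend_run (R : realType) (d : nat) (w : nat -> nat -> R)
    (x0 : 'rV[R]_d) (f : 'rV[R]_d -> R) (n m : nat) (g : nat -> 'rV[R]_d) :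
  (forall x, exists h, subdifferential f x h) ->
  (forall i, (i < n)%N -> subdifferential f (iterate w x0 g i) (g i)) ->
  exists2 h : nat -> 'rV[R]_d,
    forall i, (i < n)%N -> h i = g i &
    forall i, (i < n + m)%N -> subdifferential f (iterate w x0 h i) (h i).
Proof.
move=> f_sub g_run; elim: m => [|m [h hg h_run]].
  by exists g => // i; rewrite addn0; exact: g_run.
have [s s_sub] := f_sub (iterate w x0 h (n + m)).
pose h' i := if i == (n + m)%N then s else h i.
have h'h i : (i < n + m)%N -> h' i = h i by rewrite /h'; case: ltngtP.
have iterE i : (i <= n + m)%N -> iterate w x0 h' i = iterate w x0 h i.
  by move=> ile; apply: eq_iterate => l li; rewrite h'h // (leq_trans li).
exists h' => i.
  by move=> ltin; rewrite h'h ?hg // (leq_trans ltin) // leq_addr.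
rewrite addnS ltnS => ile; rewrite iterE //.
have [->|i_neq] := eqVneq i (n + m)%N; first by rewrite /h' eqxx; exact: s_sub.
by rewrite h'h; [apply: h_run|]; rewrite ltn_neqAle i_neq.
Qed.

(* [nat_steps W i l] is the paper's [W_{i,l}] for [1 <= i <= N + 1] and
   [l <= N], and junk elsewhere. *)
Definition nat_steps (R : realType) (N : nat) (W : 'M[R]_N.+1) (i l : nat) : R :=
  W (inord i.-1) (inord l).

Lemma fixed_step_run_iterate (R : realType) (N : nat) (W : 'M[R]_N.+1)
    (d : nat) (f : 'rV[R]_d -> R) (x0 : 'rV[R]_d) (g : nat -> 'rV[R]_d) :
  (forall i, (i <= N)%N ->
     subdifferential f (iterate (nat_steps W) x0 g i) (g i)) ->
  fixed_step_run W f (fun i => iterate (nat_steps W) x0 g i) (fun i => g i).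
Proof.
move=> g_run; split=> [i|k]; first exact: g_run (ltn_ord i).
rewrite [iterate _ _ _ ord0]/iterate big_ord0 subr0 lift0 /iterate.
rewrite (big_ord_widen _ (fun l => nat_steps W k.+1 l *: g l) (ltn_ord k)).
by congr (_ - _); apply: eq_bigr => l _; rewrite /nat_steps /= !inord_val.
Qed.

(** * Lower bounds on the worst case *)

(* The hypotheses say that the affine pieces [f j + <g j, . - x_j>] are
   consistent with [g j] being the subgradient returned at the [j]-th iterate,
   and that at [z] they are all below [v]. *)
Lemma performance_lower_bound (R : realType) (M D : R) (N : nat)
    (W : 'M[R]_N.+1) (n : nat) (d : nat) (g : nat -> 'rV[R]_d)
    (f : nat -> R) (z : 'rV[R]_d) (v : R)
    (x := iterate (nat_steps W) 0 g) :
  (n <= N.+1)%N -> 0 <= M -> enorm z <= D ->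
  (forall j, (j <= n)%N -> enorm (g j) <= M) ->
  (forall i, (i < n)%N -> v <= f i) ->
  (forall i j, (i < n)%N -> (j <= n)%N ->
     f j + dotv (g j) (x i - x j) <= f i) ->
  (forall j, (j <= n)%N -> f j + dotv (g j) (z - x j) <= v) ->
  exists2 t, performance M D W (inord n) t & f n - v <= t.
Proof.
move=> nN M0 zD gM vf f_ge zv.
pose c (j : 'I_n.+1) := f j - dotv (g j) (x j).
pose F := max_affine v c (fun j : 'I_n.+1 => g j).
have pieceE (j : 'I_n.+1) y : c j + dotv (g j) y = f j + dotv (g j) (y - x j).
  by rewrite /c dotvBr; ring.
have F_ge y : v <= F y by exact: max_affine_floor.
have Fz : F z = v.
  apply/le_anti; rewrite F_ge andbT; apply/max_affineP; split=> // j.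
  by rewrite pieceE zv // -ltnS.
have g_run i : (i < n)%N -> subdifferential F (x i) (g i).
  move=> ltin; have lei : (i < n.+1)%N by rewrite ltnS ltnW.
  apply: (max_affine_subgradient (j := Ordinal lei)); rewrite pieceE /= subrr.
  rewrite [dotv _ 0]dotvC dotv0l addr0.
  apply/max_affineP; split=> [|j]; first exact: vf.
  by rewrite pieceE f_ge // -ltnS.
have [h hg h_run] := extend_run (N.+1 - n)
  (max_affine_subdifferential v c (fun j : 'I_n.+1 => g j)) g_run.
pose X := iterate (nat_steps W) 0 h.
have Xx i : (i <= n)%N -> X i = x i.
  by move=> lein; apply: eq_iterate => l li; apply: hg; exact: leq_trans lein.
exists (F (X n) - v).
  exists d, F, (fun i : 'I_N.+2 => X i), (fun i : 'I_N.+1 => h i), z; split.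
  - split; first exact: max_affine_convex.
      by apply: max_affine_lipschitz => // j; rewrite gM // -ltnS.
    exists z; first by move=> y; rewrite Fz F_ge.
    by rewrite /X /iterate big_ord0 subrr sub0r enormN.
  - by move=> y; rewrite Fz F_ge.
  - apply: fixed_step_run_iterate => i iN.
    by apply: h_run; rewrite subnKC.
  - by rewrite Fz inordK.
rewrite lerD2r Xx //.
have := max_affine_ge v c (fun j : 'I_n.+1 => g j) (x n) ord_max.
by rewrite pieceE /= subrr [dotv _ 0]dotvC dotv0l addr0.
Qed.

(* The lower bound of [performance_lower_bound] normalised to [M = D = 1], but
   with gradients and [z] of norm at most [L]: this spares normalising the
   perturbed gradients below. *)
Definition resists_oracles (R : realType) (w : nat -> nat -> R) (n : nat) :
    Prop :=
  forall (d : nat) (g : nat -> 'rV[R]_d) (f : nat -> R) (z : 'rV[R]_d)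
    (v L : R) (x := iterate w 0 g),
  0 < L -> dotv z z <= L ^+ 2 ->
  (forall j, (j <= n)%N -> dotv (g j) (g j) <= L ^+ 2) ->
  (forall i, (i < n)%N -> v <= f i) ->
  (forall i j, (i < n)%N -> (j <= n)%N ->
     f j + dotv (g j) (x i - x j) <= f i) ->
  (forall j, (j <= n)%N -> f j + dotv (g j) (z - x j) <= v) ->
  f n - v <= L ^+ 2 / Num.sqrt n.+1%:R.

(** Homogeneity: gradients scale by [M / L], points by [D / L] and values by [M * D / L ^+ 2], which
    turns the stepsizes [M / D * nat_steps W i l] back into those of [W]. *)
Lemma optimal_resists_oracles (R : realType) (M D : R) (N n : nat)
    (W : 'M[R]_N.+1) :
  0 < M -> 0 < D -> (n <= N.+1)%N ->
  is_max (performance M D W (inord n)) (M * D / Num.sqrt n.+1%:R) ->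
  resists_oracles (fun i l => M / D * nat_steps W i l) n.
Proof.
move=> M0 D0 nN [_ maxn] d g f z v L x L0 zL gL vf f_ge zv.
have scaled_norm (a : R) (y : 'rV[R]_d) :
    0 < a -> dotv y y <= L ^+ 2 -> enorm (a / L *: y) <= a.
  move=> a0 yL; rewrite /enorm dotvZl dotvZr mulrA -expr2.
  rewrite -[leRHS](ger0_norm (ltW a0)) -sqrtr_sqr ler_wsqrtr //.
  rewrite -[leRHS](@divfK _ (L ^+ 2)) ?expf_neq0 ?gt_eqF // -expr_div_n.
  by rewrite ler_wpM2l ?sqr_ge0.
pose c := M * D / L ^+ 2.
have c0 : 0 < c by rewrite divr_gt0 ?mulr_gt0 ?exprn_gt0.
have xE i : iterate (nat_steps W) 0 (fun j => M / L *: g j) i = D / L *: x i.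
  rewrite /x /iterate !sub0r scalerN; congr (- _).
  rewrite scaler_sumr; apply: eq_bigr => l _; rewrite !scalerA; congr (_ *: _).
  by field; rewrite !gt_eqF.
have dotE j y : dotv (M / L *: g j) (D / L *: y) = c * dotv (g j) y.
  by rewrite dotvZl dotvZr /c; field; rewrite gt_eqF.
have [|||||||t /maxn t_le fv_le] := @performance_lower_bound R M D N W n d
  (fun j => M / L *: g j) (fun j => c * f j) (D / L *: z) (c * v) => //.
- exact: ltW.
- exact: scaled_norm.
- by move=> j jn; apply: scaled_norm => //; exact: gL.
- by move=> i lin; rewrite ler_pM2l // vf.
- by move=> i j lin jn; rewrite !xE -scalerBr dotE -mulrDr ler_pM2l // f_ge.
- by move=> j jn; rewrite !xE -scalerBr dotE -mulrDr ler_pM2l // zv.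
have := le_trans fv_le t_le; rewrite -mulrBr -ler_pdivlMl //.
congr (_ <= _); rewrite /c; field.
by rewrite !gt_eqF // sqrtr_gt0 ltr0n.
Qed.

(** * First-order perturbation of the orthonormal worst case *)

Lemma small_scaling (R : realType) (I : finType) (K b : I -> R) :
  (forall i, 0 < b i) ->
  exists2 e0 : R, 0 < e0 & forall e, 0 < e -> e <= e0 -> forall i, e * K i <= b i.
Proof.
move=> b0; exists (\big[Order.min/1]_i (b i / (1 + `|K i|))).
  apply: lt_bigmin => // i _.
  by rewrite divr_gt0 // (lt_le_trans ltr01) // lerDl.
move=> e e0 e_le i.
have K1 : 0 < 1 + `|K i| by rewrite (lt_le_trans ltr01) // lerDl.
have : e <= b i / (1 + `|K i|) by apply: le_trans e_le (bigmin_le _ i _).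
rewrite ler_pdivlMr //; apply: le_trans.
by rewrite ler_pM2l // (le_trans (ler_norm _)) // lerDr.
Qed.

Lemma sum_delta (R : realType) (n j : nat) (F : nat -> R) : (j < n)%N ->
  \sum_(k < n) (k == j :> nat)%:R * F k = F j.
Proof.
move=> jn; rewrite (bigD1 (Ordinal jn)) //= eqxx mul1r big1 ?addr0 // => k.
by rewrite -val_eqE /= => /negPf ->; rewrite mul0r.
Qed.

(* Derivative at [0] of the Gram matrix of the canonical basis when its [p]-th
   vector is moved in the direction [u], with [u p = 0]. *)
Definition gram_deriv (R : realType) (p : nat) (u : nat -> R) (l j : nat) : R :=
  (l == p)%:R * u j + (j == p)%:R * u l.

(* The point [z] of the unit ball is chosen so that all the perturbed pieces
   take there the same value [v], so low that the gap [e * phi n - v] exceeds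
   the guarantee of the method if the conclusion fails.  For [j < i] the consistency constraint between the
   [i]-th and [j]-th pieces has the slack [w i j > 0] at [e = 0], so only the
   constraints with [i < j] remain. *)
Lemma first_order_optimality (R : realType) (w : nat -> nat -> R) (n p : nat)
    (u phi : nat -> R)
    (s := fun i j => \sum_(l < i) w i l * gram_deriv p u l j) :
  resists_oracles w n -> (p <= n)%N -> u p = 0 ->
  (forall i j, (j < i)%N -> (i < n)%N -> 0 < w i j) ->
  (forall i j, (i < j)%N -> (j <= n)%N -> phi j - s i j + s j j <= phi i) ->
  n.+1%:R * phi n - \sum_(j < n.+1) (phi j + s j j) +
    (\sum_(j < n.+1) u j) / Num.sqrt n.+1%:R <= 0.
Proof.
move=> w_opt pn up0 w_gt0 phi_ge; rewrite leNgt; apply/negP.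
set T := (X in 0 < X) => T0.
pose sg : R := (Num.sqrt n.+1%:R)^-1.
have n0 : 0 < n.+1%:R :> R by rewrite ltr0n.
have sg0 : 0 < sg by rewrite invr_gt0 sqrtr_gt0.
have sg2 : n.+1%:R * sg ^+ 2 = 1.
  by rewrite exprVn sqr_sqrtr ?ltW // divff // gt_eqF.
(* [tau] is the first-order term of [v]. With [tau = phi n] the [beta j] would sum to [T]; the shift
   keeps half of this to shrink [z] and spends the rest on widening the gap. *)
pose tau := phi n - T / 2 / n.+1%:R.
(* Since the inner product of [g j] and [x_j] is [- (e * s j j)], piece [j] equals [v] at [z] when
   that of [g j] and [z] is [v + e * b j]. *)
pose b j := - (phi j + s j j).
pose su := \sum_(j < n.+1) u j.
pose U := \sum_(k < n.+1) u k ^+ 2.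
(* [beta] and [eta] are the coefficients of [e] and [e ^+ 2] in the coordinates of [z], whose
   constant term is [- sg]. *)
pose beta j := tau + b j + (j == p)%:R * (sg * su).
pose eta j := - ((j == p)%:R * \sum_(k < n.+1) u k * (tau + b k)).
have sum_beta : \sum_(j < n.+1) beta j = T / 2.
  rewrite 2!big_split /= sumr_const card_ord (sum_delta (fun=> sg * su)) //.
  rewrite /tau -mulr_natl.
  have -> : \sum_(j < n.+1) b j = - \sum_(j < n.+1) (phi j + s j j).
    exact: sumrN.
  have -> : T = n.+1%:R * phi n - \sum_(j < n.+1) (phi j + s j j) + su * sg by [].
  by field; rewrite gt_eqF.
pose K2 := \sum_(j < n.+1) (2 * beta j ^+ 2 + 2 * eta j ^+ 2 - 2 * sg * eta j).
(* The value 1 is a harmless positive default for pairs without slack. *)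
pose w' (ij : 'I_n * 'I_n) := if (ij.2 < ij.1)%N then w ij.1 ij.2 else 1.
have w'_gt0 ij : 0 < w' ij.
  by rewrite /w'; case: ifP => // ji; apply: w_gt0; rewrite // ltn_ord.
(* [e1] serves the constraints with slack, [e2] the floor [v], [e3] the norm of [z], and [e4] the
   excess of the gap over the guarantee. *)
have [e1 e1_gt0 He1] := @small_scaling R _
  (fun ij : 'I_n * 'I_n => phi ij.2 - s ij.1 ij.2 + s ij.2 ij.2 - phi ij.1)
  w' w'_gt0.
have [e2 e2_gt0 He2] := @small_scaling R 'I_n
  (fun i => tau - phi i) (fun=> sg) (fun=> sg0).
have [e3 e3_gt0 He3] := @small_scaling R unit
  (fun=> K2) (fun=> sg * T) (fun=> mulr_gt0 sg0 T0).
have T4 : 0 < T / 4 / n.+1%:R by rewrite !divr_gt0.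
have [e4 e4_gt0 He4] := @small_scaling R unit
  (fun=> U * sg) (fun=> T / 4 / n.+1%:R) (fun=> T4).
pose e := Order.min 1 (Order.min (Order.min e1 e2) (Order.min e3 e4)).
have e_gt0 : 0 < e by rewrite !lt_min ltr01 e1_gt0 e2_gt0 e3_gt0.
have : e <= e by []; rewrite {2}/e !le_min.
move=> /and3P[e_le1 /andP[ee1 ee2] /andP[ee3 ee4]].
have {}He1 := He1 _ e_gt0 ee1; have {}He2 := He2 _ e_gt0 ee2.
have {}He3 := He3 _ e_gt0 ee3 tt; have {}He4 := He4 _ e_gt0 ee4 tt.
move: (e) e_gt0 e_le1 He1 He2 He3 He4 => {e ee1 ee2 ee3 ee4} e e_gt0 e_le1.
move=> He1 He2 He3 He4.
pose g j : 'rV[R]_n.+1 := \row_k ((k == j :> nat)%:R + (j == p)%:R * (e * u k)).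
pose v := - sg + e * tau.
pose z : 'rV[R]_n.+1 :=
  \row_k (v + e * b k - (k == p :> nat)%:R * (e * \sum_(l < n.+1) u l * (v + e * b l))).
have gE (j : nat) (h : nat -> R) : (j <= n)%N ->
    dotv (g j) (\row_(k < n.+1) h k) =
      h j + (j == p)%:R * (e * \sum_(k < n.+1) u k * h k).
  move=> jn; rewrite -[in RHS](@sum_delta R n.+1 j h jn) !mulr_sumr -big_split.
  by apply: eq_bigr => k _; rewrite !mxE /=; ring.
have gramE l j : (l <= n)%N -> (j <= n)%N ->
    dotv (g j) (g l) = (j == l)%:R + e * gram_deriv p u l j
      + (j == p)%:R * (l == p)%:R * (e ^+ 2 * U).
  move=> ln jn.
  rewrite {2}/g (gE j (fun k => (k == l)%:R + (l == p)%:R * (e * u k))) //.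
  rewrite /gram_deriv.
  under eq_bigr => k _ do rewrite mulrDr [u k * _]mulrC [u k * _]mulrCA.
  rewrite big_split /= (sum_delta u) //.
  have -> : \sum_(i < n.+1) (l == p)%:R * (u i * (e * u i)) = (l == p)%:R * (e * U).
    by rewrite /U !mulr_sumr; apply: eq_bigr => k _; ring.
  by ring.
(* Exact: the [e ^+ 2] term of the Gram matrix needs [l = j = p], excluded by [l < i <= j]. *)
have gx i j : (j <= n)%N -> (i <= n)%N -> (i <= j)%N ->
    dotv (g j) (iterate w 0 g i) = - (e * s i j).
  move=> jn lin ij; rewrite /iterate sub0r dotvNr dotv_sumr mulr_sumr.
  congr (- _); apply: eq_bigr => l _; rewrite dotvZr gramE //; last first.
    by apply: leq_trans lin; exact: ltnW.
  have lj : (l < j)%N by exact: leq_trans ij.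
  rewrite (gtn_eqF lj); have [jp|jp] := eqVneq j p; last by rewrite /=; ring.
  by rewrite -jp (ltn_eqF lj) /=; ring.
have U0 : 0 <= U by apply: sumr_ge0 => k _; exact: sqr_ge0.
(* Here that term can occur, but positive stepsizes give it a favourable sign. *)
have gx_lt i j : (j < i)%N -> (i < n)%N ->
    dotv (g j) (iterate w 0 g i) <= - w i j - e * s i j.
  move=> ji lin; have jn : (j <= n)%N by apply: ltnW; exact: ltn_trans lin.
  rewrite /iterate sub0r dotvNr dotv_sumr -opprD lerN2.
  rewrite -[X in X + _](sum_delta (w i) ji) /s mulr_sumr -big_split /=.
  apply: ler_sum => l _.
  have ln : (l <= n)%N by apply: ltnW; exact: ltn_trans (ltn_ord l) lin.
  rewrite dotvZr gramE // [j == l]eq_sym.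
  rewrite [leRHS](_ : _ = (l == j :> nat)%:R * w i l +
      e * (w i l * gram_deriv p u l j) +
      w i l * ((j == p)%:R * (l == p :> nat)%:R * (e ^+ 2 * U))); last by ring.
  rewrite lerDl.
  rewrite !mulr_ge0 ?ler0n ?sqr_ge0 // ?ltW //.
  by apply: w_gt0; rewrite ?ltn_ord.
have L2_gt0 : 0 < 1 + e ^+ 2 * U.
  by rewrite ltr_pwDl // mulr_ge0 // sqr_ge0.
pose L := Num.sqrt (1 + e ^+ 2 * U).
have L2 : L ^+ 2 = 1 + e ^+ 2 * U by rewrite sqr_sqrtr // ltW.
(* The correction in coordinate [p] of [z] cancels the effect of [e * u] in [g p]; as [u p = 0], it
   adds no further term. *)
have zv j : (j <= n)%N -> dotv (g j) z = v + e * b j.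
  move=> jn; pose h k := v + e * b k -
    (k == p)%:R * (e * \sum_(l < n.+1) u l * (v + e * b l)).
  rewrite -[z]/(\row_k h k) gE // /h.
  under [X in _ + _ * (_ * X)]eq_bigr => k _ do rewrite mulrBr.
  rewrite big_split /= [X in _ + _ * (_ * (_ + X))]big1; first by ring.
  move=> k _; have [->|_] := eqVneq (k : nat) p; first by rewrite up0 mul0r oppr0.
  by rewrite mul0r mulr0 oppr0.
have z_norm : dotv z z <= 1.
  have -> : dotv z z = n.+1%:R * sg ^+ 2 - e * (2 * sg * \sum_(j < n.+1) beta j)
      + \sum_(j < n.+1)
          (e ^+ 2 * ((beta j + e * eta j) ^+ 2 - 2 * sg * eta j)).
    rewrite -[in n.+1%:R](card_ord n.+1) mulr_natl -sumr_const !mulr_sumr.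
    rewrite -sumrB -big_split; apply: eq_bigr => k _; rewrite !mxE /=.
    have -> : \sum_(l < n.+1) u l * (v + e * b l) =
        - (sg * su) + e * \sum_(l < n.+1) u l * (tau + b l).
      rewrite /su !mulr_sumr -sumrN -big_split; apply: eq_bigr => l _.
      by rewrite /v /=; ring.
    by rewrite /v /beta /eta; case: (_ == p); rewrite /=; ring.
  rewrite sg2 sum_beta -subr_le0.
  apply: (@le_trans _ _ (- (e * (sg * T)) + e * (e * K2))); last first.
    by rewrite addrC subr_le0 ler_pM2l.
  rewrite (_ : _ - 1 = - (e * (sg * T)) + \sum_(j < n.+1)
    (e ^+ 2 * ((beta j + e * eta j) ^+ 2 - 2 * sg * eta j))); last by field.
  rewrite lerD2l mulrA -expr2 /K2 mulr_sumr; apply: ler_sum => k _.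
  rewrite ler_wpM2l ?sqr_ge0 // lerD2r.
  have : e ^+ 2 * eta k ^+ 2 <= eta k ^+ 2.
    by rewrite ler_piMl ?sqr_ge0 // exprn_ile1 // ltW.
  have := sqr_ge0 (beta k - e * eta k); rewrite !expr2; lra.
have := w_opt n.+1 g (fun j => e * phi j) z v L.
have -> : e * phi n - v = sg + e * (T / 2 / n.+1%:R).
  by rewrite /v /tau; ring.
rewrite L2 -/sg => concl.
(* The gap exceeds [sg] by a term of order [e], the guarantee only by one of order [e ^+ 2]. *)
suff : sg + e * (T / 2 / n.+1%:R) <= (1 + e ^+ 2 * U) * sg.
  apply/negP; rewrite -ltNge mulrDl mul1r ltrD2l expr2 -!mulrA ltr_pM2l //.
  apply: le_lt_trans He4 _.
  rewrite -!mulrA ltr_pM2l // ltr_pM2r ?invr_gt0 //.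
  by rewrite ltf_pV2 ?posrE // ltr_nat.
apply: concl.
- by rewrite sqrtr_gt0.
- by apply: le_trans z_norm _; rewrite lerDl mulr_ge0 // sqr_ge0.
- move=> j jn; rewrite gramE // /gram_deriv eqxx.
  have [->|_] := eqVneq j p; rewrite ?up0 /= !(mulr0, mul0r, addr0, mul1r) //.
  by rewrite lerDl mulr_ge0 // sqr_ge0.
- move=> i lin; have := He2 (Ordinal lin); rewrite /= /v; lra.
- move=> i j lin jn; rewrite dotvBr (gx j j) // opprK addrA.
  have [ji|ij|->] := ltngtP j i; last by rewrite (gx i i) ?(ltnW lin) // subrK.
    have := He1 (Ordinal lin, Ordinal (ltn_trans ji lin)).
    rewrite /w' /= ji; have := gx_lt i j ji lin; lra.
  rewrite (gx i j) ?(ltnW lin) ?(ltnW ij) //.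
  have : e * (phi j - s i j + s j j) <= e * phi i by rewrite ler_pM2l // phi_ge.
  lra.
- by move=> j jn; rewrite dotvBr zv // (gx j j) // /b; lra.
Qed.

(** * Inequalities on the stepsizes *)

(** Strong induction on the row. If [w n l <= 0], moving [e_n] towards [e_l] with [phi = 0] respects
    all constraints, as earlier rows are positive; optimality then forces [w n l] to be at least the
    inverse of the root of [n + 1]. *)
Lemma stepsizes_gt0 (R : realType) (w : nat -> nat -> R) (m : nat) :
  (forall n, (n <= m)%N -> resists_oracles w n) ->
  forall i j, (j < i)%N -> (i <= m)%N -> 0 < w i j.
Proof.
move=> w_opt i; elim/ltn_ind: i => n IH l ln nm; rewrite ltNge; apply/negP => wnl.
pose u k : R := (k == l)%:R.
have sE i j : (i <= n)%N -> \sum_(k < i) w i k * gram_deriv n u k j =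
    (j == n)%:R * if (l < i)%N then w i l else 0.
  move=> lein; rewrite [RHS](_ : _ = \sum_(k < i) (j == n)%:R * (w i k * u k)).
    apply: eq_bigr => k _; rewrite /gram_deriv.
    by rewrite (ltn_eqF (leq_trans (ltn_ord k) lein)) mul0r add0r mulrCA.
  rewrite -mulr_sumr; congr (_ * _); under eq_bigr do rewrite mulrC.
  case: ifP => [li|il]; first by rewrite sum_delta.
  rewrite big1 // => k _; rewrite /u; case: eqP => [kl|]; last by rewrite mul0r.
  by rewrite -kl ltn_ord in il.
have u_n : u n = 0 by rewrite /u (gtn_eqF ln).
have w_gt0 i j : (j < i)%N -> (i < n)%N -> 0 < w i j.
  by move=> ji lin; apply: IH => //; apply: leq_trans nm; exact: ltnW.
have concl := first_order_optimality (phi := fun=> 0) (w_opt n nm) (leqnn n) u_n w_gt0.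
suff /concl : forall i j, (i < j)%N -> (j <= n)%N ->
   0 - \sum_(k < i) w i k * gram_deriv n u k j +
   \sum_(k < j) w j k * gram_deriv n u k j <= 0.
  rewrite mulr0 add0r; apply/negP; rewrite -ltNge.
  have -> : \sum_(j < n.+1) (0 + \sum_(k < j) w j k * gram_deriv n u k j) = w n l.
    under eq_bigr => j _ do rewrite add0r (sE _ _ (ltn_ord j)).
    by rewrite (sum_delta (fun j => if (l < j)%N then w j l else 0)) // ln.
  have -> : \sum_(j < n.+1) u j = 1.
    under eq_bigr => j _ do rewrite /u -[_%:R]mulr1.
    by rewrite (sum_delta (fun=> 1)) // ltnS ltnW.
  by rewrite ltr_wpDl ?oppr_ge0 // div1r invr_gt0 sqrtr_gt0 ltr0n.
move=> i j ij jn; rewrite sub0r !sE // ?(leq_trans (ltnW ij)) //.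
have [jE|_] := eqVneq j n; last by rewrite !mul0r oppr0 addr0.
rewrite jE in ij *; rewrite !mul1r ln addrC; case: ifP => [li|_]; last by rewrite oppr0 addr0.
rewrite subr_le0; exact: le_trans wnl (ltW (w_gt0 _ _ li ij)).
Qed.

(** [e_1] moves along [- e_0], and [phi] raises the last value until its constraint at [x_0] is
    tight. *)
Lemma step_10_le (R : realType) (w : nat -> nat -> R) :
  resists_oracles w 1 -> 2 * w 1%N 0%N <= (Num.sqrt 2)^-1.
Proof.
move=> w_opt.
have := @first_order_optimality R w 1 1 (nth 0 [:: -1]) (nth 0 [:: 0; w 1%N 0%N])
  w_opt isT erefl.
rewrite /gram_deriv !big_ord_recl !big_ord0 /=.
move=> concl; rewrite -subr_le0; apply: le_trans (concl _ _).
- lra.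
- by move=> [|[|i]] [|j].
- move=> [|[|i]] [|[|j]] // _ _; rewrite !big_ord_recl !big_ord0 /=; lra.
Qed.

(** [e_2] moves along [- e_1]; the last value rises until its constraints at [x_0] and [x_1] are
    tight. *)
Lemma step_21_le (R : realType) (w : nat -> nat -> R) :
  (forall n, (n <= 2)%N -> resists_oracles w n) ->
  3 * w 2%N 1%N <= (Num.sqrt 3)^-1.
Proof.
move=> w_opt; have w_gt0 := stepsizes_gt0 w_opt.
have := @first_order_optimality R w 2 2 (nth 0 [:: 0; -1])
  (nth 0 [:: 0; 0; w 2%N 1%N]) (w_opt 2%N isT) isT erefl.
rewrite /gram_deriv !big_ord_recl !big_ord0 /=.
move=> concl; rewrite -subr_le0; apply: le_trans (concl _ _).
- lra.
- by move=> i j ji lin; apply: w_gt0 => //; exact: ltnW.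
- have w10 := w_gt0 1%N 0%N isT isT; have w21 := w_gt0 2%N 1%N isT isT.
  by move=> [|[|[|i]]] [|[|[|j]]] // _ _;
     rewrite !big_ord_recl !big_ord0 /=; lra.
Qed.

(** [e_0] moves along [e_1 + e_2], and [phi] makes all three constraints with [i < j] tight. *)
Lemma step_20_ge (R : realType) (w : nat -> nat -> R) :
  (forall n, (n <= 2)%N -> resists_oracles w n) ->
  2 * (Num.sqrt 3)^-1 <= 3 * w 2%N 0%N.
Proof.
move=> w_opt; have w_gt0 := stepsizes_gt0 w_opt.
have := @first_order_optimality R w 2 0 (nth 0 [:: 0; 1; 1])
  (nth 0 [:: w 2%N 0%N; w 2%N 0%N - w 1%N 0%N; 0]) (w_opt 2%N isT) isT erefl.
rewrite /gram_deriv !big_ord_recl !big_ord0 /=.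
move=> concl; rewrite -subr_le0; apply: le_trans (concl _ _).
- lra.
- by move=> i j ji lin; apply: w_gt0 => //; exact: ltnW.
- by move=> [|[|[|i]]] [|[|[|j]]] // _ _;
     rewrite !big_ord_recl !big_ord0 /=; lra.
Qed.

(** The direction is [- e_0 + k e_1], with [k] making it orthogonal to the unperturbed step
    [x_2 - x_1]; the constraint of piece 2 at [x_1] is then tight with [phi = 0]. The unmoved pieces
    3 to 5 serve to enlarge the root dividing [k - 1]. *)
Lemma step_10_20_21_le (R : realType) (w : nat -> nat -> R) :
  (forall n, (n <= 5)%N -> resists_oracles w n) ->
  w 1%N 0%N + ((w 2%N 0%N - w 1%N 0%N) / w 2%N 1%N - 1) / Num.sqrt 6 <= 0.
Proof.
move=> w_opt; have w_gt0 := stepsizes_gt0 w_opt.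
set k := _ / w 2%N 1%N.
have w10 := w_gt0 1%N 0%N isT isT; have w21 := w_gt0 2%N 1%N isT isT.
have kE : w 2%N 1%N * k = w 2%N 0%N - w 1%N 0%N.
  by rewrite /k mulrC divfK // gt_eqF.
have := @first_order_optimality R w 5 2 (nth 0 [:: -1; k]) (fun=> 0)
  (w_opt 5%N isT) isT erefl.
rewrite /gram_deriv !big_ord_recl !big_ord0 /=.
move=> concl; apply: le_trans (concl _ _).
- lra.
- by move=> i j ji lin; apply: w_gt0 => //; exact: ltnW.
- by move=> [|[|[|[|[|[|i]]]]]] [|[|[|[|[|[|j]]]]]] // _ _;
     rewrite !big_ord_recl !big_ord0 /=; lra.
Qed.

(** * Incompatibility of the stepsize inequalities *)

Theorem corollary1p5 (R : realType) (M D : R) (N : nat)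
    (hM : 0 < M) (hD : 0 < D) (hN : (5 <= N)%N) :
  ~ exists W : 'M[R]_N,
      is_trig_mx W /\
      forall n : 'I_N.+1,
        is_max (performance M D W n) (M * D / Num.sqrt (n.+1)%:R).
Proof.
case: N hN => // N hN [W [_ W_opt]].
pose w i l := M / D * nat_steps W i l.
have w_opt n : (n <= 5)%N -> resists_oracles w n.
  move=> n5; have nN : (n <= N.+1)%N by exact: leq_trans hN.
  apply: optimal_resists_oracles => //.
  by have := W_opt (inord n); rewrite inordK.
have w_opt2 n : (n <= 2)%N -> resists_oracles w n.
  by move=> n2; apply: w_opt; exact: leq_trans n2 _.
have := step_10_20_21_le w_opt; have := step_20_ge w_opt2; have := step_21_le w_opt2.
have := step_10_le (w_opt 1%N isT).
have w_gt0 := stepsizes_gt0 w_opt2.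
have := w_gt0 1%N 0%N isT isT; have := w_gt0 2%N 1%N isT isT.
have -> : 6 = 2 * 3 :> R by rewrite -natrM.
rewrite sqrtrM ?ler0n //.
have r2_gt0 : 0 < Num.sqrt 2 :> R by rewrite sqrtr_gt0.
have r3_gt0 : 0 < Num.sqrt 3 :> R by rewrite sqrtr_gt0.
have r22 : Num.sqrt 2 * Num.sqrt 2 = 2 :> R by rewrite -expr2 sqr_sqrtr.
have r33 : Num.sqrt 3 * Num.sqrt 3 = 3 :> R by rewrite -expr2 sqr_sqrtr.
move: (Num.sqrt 2) (Num.sqrt 3) r2_gt0 r3_gt0 r22 r33 => r2 r3 r2_gt0 r3_gt0 r22 r33.
move: (w 1%N 0%N) (w 2%N 1%N) (w 2%N 0%N) => a b c b_gt0 a_gt0.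
have -> : r2^-1 = r2 / 2 by rewrite -r22; field; rewrite gt_eqF.
have -> : r3^-1 = r3 / 3 by rewrite -r33; field; rewrite gt_eqF.
move=> a_le b_le c_ge concl.
have r3_ge : 173 / 100 <= r3 by nra.
have r3_le : r3 <= 2 by nra.
have r2_le : r2 <= 1415 / 1000 by nra.
(* With denominators cleared, the left side is nonincreasing in [b] because [r2 * r3 * a <= 1], and
   at [b = r3 / 9] it decreases in [a]. The extreme values of [a], [b] and [c] leave
   [r3 / 9 <= r2 / 4 - 1 / 6], refuted by the rational bounds on the roots. *)
have : r2 * r3 * b * (a + ((c - a) / b - 1) / (r2 * r3)) <= 0.
  by rewrite pmulr_rle0 // !mulr_gt0.
have -> : r2 * r3 * b * (a + ((c - a) / b - 1) / (r2 * r3)) =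
    r2 * r3 * a * b + c - a - b by field; rewrite !gt_eqF.
have r2a_le : r2 * a <= 1 / 2 by nra.
have X_le : r2 * r3 * a <= 1 by nra.
have : (1 - r2 * r3 * a) * b <= (1 - r2 * r3 * a) * (r3 / 9).
  by rewrite ler_wpM2l //; lra.
have -> : (1 - r2 * r3 * a) * (r3 / 9) = r3 / 9 - r2 * a * (r3 * r3) / 9 by field.
rewrite r33.
have : (1 - r2 / 3) * a <= (1 - r2 / 3) * (r2 / 4).
  by rewrite ler_wpM2l //; lra.
have -> : (1 - r2 / 3) * (r2 / 4) = r2 / 4 - r2 * r2 / 12 by field.
rewrite r22; lra.
Qed.
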